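(* Let $(X,\mathcal{A})$ be a measurable space, let $\mu\colon\mathcal{A}\to[0,\infty]$ be a nonadditive measure, and let $0<p<\infty$ and $0<q<\infty$. Assume that $\mu$ is relaxed subadditive. If $\mu$ is order continuous and autocontinuous from above, then $(\mathfrak{Su}(\mu),\mathcal{T})$ and $(\mathit{Su}(\mu),\widetilde{\mathcal{T}})$ are topological linear spaces satisfying the open sphere condition. Furthermore, $\widetilde{\mathcal{T}}$ is completely regular.
   Context: $(X,\mathcal{A})$ is a measurable space ($X$ nonempty, $\mathcal{A}$ a $\sigma$-field of subsets of $X$) and $\mathcal{F}_0(X)$ is the real linear space of all $\mathcal{A}$-measurable real-valued functions on $X$. A nonadditive measure is a set function $\mu\colon\mathcal{A}\to[0,\infty]$ with $\mu(\emptyset)=0$ and $\mu(A)\le\mu(B)$ whenever $A,B\in\mathcal{A}$, $A\subset B$. It is: relaxed subadditive if there is a constant $K\ge1$ with $\mu(A\cup B)\le K\{\mu(A)+\mu(B)\}$ for all disjoint $A,B\in\mathcal{A}$; order continuous if $\mu(A_n)\to0$ whenever $A_n\in\mathcal{A}$ is nonincreasing with $\bigcap_n A_n=\emptyset$; autocontinuous from above if $\mu(A\cup B_n)\to\mu(A)$ whenever $A,B_n\in\mathcal{A}$ and $\mu(B_n)\to0$; null-additive if $\mu(A\cup B)=\mu(A)$ whenever $A,B\in\mathcal{A}$ and $\mu(B)=0$ (this follows from autocontinuity from above). For $r>0$, $\mu^{r}$ is the nonadditive measure $A\mapsto\mu(A)^{r}$. The Sugeno integral of an $\mathcal{A}$-measurable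 $f\colon X\to[0,\infty)$ is $\mathrm{Su}(\mu,f):=\sup_{t\in[0,\infty)}\min\{t,\mu(\{x\in X\colon f(x)>t\})\}$. The Sugeno-Lorentz prenorm is $(f)_{p,q}:=\mathrm{Su}(\mu^{q/p},\,p|f|^q/q)^{1/q}\in[0,\infty]$ for $f\in\mathcal{F}_0(X)$, and $\mathfrak{Su}(\mu):=\{f\in\mathcal{F}_0(X)\colon\mathrm{Su}(\mu,|f|)<\infty\}=\{f\in\mathcal{F}_0(X)\colon (f)_{p,q}<\infty\}$. Quotient: when $\mu$ is null-additive, define the equivalence relation $f\sim g$ on $\mathcal{F}_0(X)$ by $\mu(\{|f-g|>c\})=0$ for every $c>0$; $[f]$ is the equivalence class of $f$, the operations are $[f]+[g]:=[f+g]$, $\alpha[f]:=[\alpha f]$, $\mathit{Su}(\mu):=\{[f]\colon f\in\mathfrak{Su}(\mu)\}$, and $([f])_{p,q}:=(f)_{p,q}$ is well defined. Topologies: $S(f,r):=\{g\in\mathfrak{Su}(\mu)\colon (f-g)_{p,q}<r\}$ for $f\in\mathfrak{Su}(\mu)$, $r>0$, and $\mathcal{T}$ is the topology on $\mathfrak{Su}(\mu)$ consisting of all $G\subset\mathfrak{Su}(\mu)$ such that for every $f\in G$ there is $r>0$ with $S(f,r)\subset G$. Likewise $\widetilde{S}([f],r):=\{[g]\in\mathit{Su}(\mu)\colon ([f]-[g])_{p,q}<r\}$, and $\widetilde{\mathcal{T}}$ is the topology on $\mathit{Su}(\mu)$ consisting of all $\widetilde{G}\subset\mathit{Su}(\mu)$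 such that for every $[f]\in\widetilde{G}$ there is $r>0$ with $\widetilde{S}([f],r)\subset\widetilde{G}$. The topology $\mathcal{T}$ (respectively $\widetilde{\mathcal{T}}$) satisfies the open sphere condition if every sphere $S(f,r)$ (respectively $\widetilde{S}([f],r)$), $r>0$, is open with respect to it. A topological linear space is a linear space with a topology making addition and scalar multiplication (jointly) continuous. *)

(* Defs.v *)
From HB Require Import structures.
From mathcomp Require Import all_boot all_order all_algebra.
From mathcomp Require Import all_classical all_reals all_analysis.
Import Order.TTheory GRing.Theory Num.Theory.
Import numFieldNormedType.Exports.

Set Implicit Arguments.
Unset Strict Implicit.
Unset Printing Implicit Defensive.

Local Open Scope classical_set_scope.
Local Open Scope ring_scope.
Local Open Scope quotient_scope.

(* As with the measures of MathComp-Analysis, the carrier is a total function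
   on [set X], but it is constrained only on the measurable sets; its values
   elsewhere are never used. *)
Record nonadditive_measure d (X : measurableType d) (R : realType) := {
  nam_fun :> set X -> \bar R ;
  nam0 : nam_fun set0 = 0%E ;
  nam_ge0 : forall A, measurable A -> (0 <= nam_fun A)%E ;
  nam_le : forall A B, measurable A -> measurable B -> A `<=` B ->
    (nam_fun A <= nam_fun B)%E }.

Section properties.
Context d (X : measurableType d) (R : realType) (mu : set X -> \bar R).

Definition relaxed_subadditive := exists2 K : R, 1 <= K &
  forall A B, measurable A -> measurable B -> A `&` B = set0 ->
    (mu (A `|` B) <= K%:E * (mu A + mu B))%E.

Definition order_continuous := forall A : (set X)^nat,
  (forall n, measurable (A n)) -> nonincreasing_seq A ->
  \bigcap_n A n = set0 -> (fun n => mu (A n)) @ \oo --> 0%E.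

Definition autocontinuous_from_above := forall (A : set X) (B : (set X)^nat),
  measurable A -> (forall n, measurable (B n)) ->
  (fun n => mu (B n)) @ \oo --> 0%E ->
  (fun n => mu (A `|` B n)) @ \oo --> mu A.

Definition sugeno (f : X -> R) : \bar R :=
  ereal_sup [set Order.min t%:E (mu [set x | t < f x]) | t in [set t | 0 <= t]].

End properties.

Definition sugeno_prenorm d (X : measurableType d) (R : realType)
    (mu : set X -> \bar R) (p q : R) (f : X -> R) : \bar R :=
  (sugeno (fun A => mu A `^ (q / p)) (fun x => (p * `|f x| `^ q / q)%R)
    `^ q^-1)%E.

Section lemmas.
Context d (X : measurableType d) (R : realType)
  (mu : nonadditive_measure X R).
Implicit Types (A B : set X) (f g : {mfun X >-> R}).

Lemma measurable_gt_norm f (t : R) : measurable [set x | t < `|f x|].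
Proof.
have mf : measurable_fun setT (fun x => `|f x|) by exact: measurableT_comp.
rewrite -[X in measurable X]setTI.
rewrite (_ : [set x | t < `|f x|] = (fun x => `|f x|) @^-1` `]t, +oo[).
  exact: mf.
by apply/seteqP; split => x /=; rewrite in_itv/= andbT.
Qed.

Lemma relaxed_subadditiveU : relaxed_subadditive mu ->
  exists2 K : R, 1 <= K & forall A B, measurable A -> measurable B ->
    (mu (A `|` B) <= K%:E * (mu A + mu B))%E.
Proof.
move=> [K K1 H]; exists K => // A B mA mB.
have mBA : measurable (B `\` A) by exact: measurableD.
have -> : A `|` B = A `|` (B `\` A).
  apply/seteqP; split => x /=; last by case=> [|[]]; tauto.
  by case: (pselect (A x)); tauto.
apply: (le_trans (H _ _ mA mBA _)); first by rewrite setDE setICA setICr setI0.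
rewrite lee_pmul2l// ?lte_fin ?(lt_le_trans ltr01)//.
by apply: leeD => //; apply: nam_le => // x [].
Qed.

Lemma nam_linear_gt : relaxed_subadditive mu -> exists2 K : R, 1 <= K &
  forall (a : R) f g (s t : R),
    (mu [set x | (`|a| * s + t < `|(a *: f + g) x|)%R] <=
    K%:E * (mu [set x | (s < `|f x|)%R] + mu [set x | (t < `|g x|)%R]))%E.
Proof.
move=> /relaxed_subadditiveU[K K1 H]; exists K => // a f g s t.
apply: le_trans (H _ _ (measurable_gt_norm _ _) (measurable_gt_norm _ _)).
apply: nam_le; [exact: measurable_gt_norm| |].
  by apply: measurableU; exact: measurable_gt_norm.
move=> x /= fg; apply/orP; rewrite -[_ || _]negbK negb_or -!leNgt.
apply/negP => /andP[fs gt]; move: fg; rewrite ltNge => /negP; apply.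
rewrite (le_trans (ler_normD _ _))// lerD//.
by rewrite [X in `|X| <= _](_ : _ = a * f x)// normrM ler_wpM2l.
Qed.

Lemma sugeno_lty f : (sugeno mu (fun x => `|f x|%R) < +oo)%E <->
  exists2 t : R, 0 <= t & (mu [set x | (t < `|f x|)%R] < +oo)%E.
Proof.
split=> [sf|[t t0 mut]].
  have [M sfM] : exists M : R, (sugeno mu (fun x => `|f x|%R) <= M%:E)%E.
    move: sf; case: (sugeno _ _) => [r _|//|_]; first by exists r.
    by exists 0; exact: leNye.
  exists (`|M| + 1); first by rewrite addr_ge0.
  have : (Order.min (`|M| + 1)%:E (mu [set x | (`|M| + 1 < `|f x|)%R]) <=
      M%:E)%E.
    apply: le_trans sfM; apply: ereal_sup_ubound.
    by exists (`|M| + 1) => //=; rewrite addr_ge0.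
  rewrite ge_min lee_fin => /orP[|/le_lt_trans]; last by apply; exact: ltry.
  by rewrite leNgt ltr_pwDr// ler_norm.
have mu0 : (0 <= mu [set x | (t < `|f x|)%R])%E.
  exact/nam_ge0/measurable_gt_norm.
apply: (@le_lt_trans _ _ (t%:E + mu [set x | (t < `|f x|)%R])%E).
  apply: ge_ereal_sup => _ [s /= s0 <-]; rewrite ge_min.
  have [st|ts] := leP s t.
    by rewrite (le_trans _ (leeDl _ mu0)) ?lee_fin.
  apply/orP; right; apply: le_trans (leeDr _ _); last by rewrite lee_fin.
  apply: nam_le; [exact: measurable_gt_norm..|].
  by move=> x /=; exact: lt_trans.
by rewrite lte_add_pinfty// ltry.
Qed.

End lemmas.

Section function_space.
Context d (X : measurableType d) (R : realType)
  (mu : nonadditive_measure X R).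
Local Notation mfunL := [the lmodType R of {mfun X >-> R}].

(* The hypothesis [mu_sub] is a parameter so that the linear structure,
   which exists only under relaxed subadditivity, can be canonical. *)
Definition sugeno_finite (mu_sub : relaxed_subadditive mu) :
    {pred mfunL} :=
  fun f => (sugeno mu (fun x => `|f x|%R) < +oo)%E.

Definition sugeno_null (mu_sub : relaxed_subadditive mu) :
    {pred mfunL} :=
  fun f => `[< forall c : R, 0 < c -> mu [set x | c < `|f x|] = 0%E >].

Hypothesis mu_sub : relaxed_subadditive mu.

Lemma sugeno_finite_submod_closed : submod_closed (sugeno_finite mu_sub).
Proof.
split=> [|a f g].
  apply/sugeno_lty; exists 0 => //.
  rewrite [X in mu X](_ : _ = set0) ?nam0// -subset0 => x /=.
  by rewrite normr0 ltxx.
move=> /sugeno_lty[s s0 fs] /sugeno_lty[t t0 gt]; apply/sugeno_lty.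
exists (`|a| * s + t); first by rewrite addr_ge0// mulr_ge0.
have [K K1 H] := nam_linear_gt mu_sub; apply: le_lt_trans (H _ _ _ _ _) _.
have K0 : 0 <= K by exact: le_trans K1.
rewrite lte_mul_pinfty ?lee_fin//; exact: lte_add_pinfty.
Qed.
HB.instance Definition _ := GRing.isSubmodClosed.Build R _
  (sugeno_finite mu_sub : {pred mfunL})
  sugeno_finite_submod_closed.

Lemma sugeno_null_submod_closed : submod_closed (sugeno_null mu_sub).
Proof.
split=> [|a f g].
  apply/asboolP => c c0.
  rewrite [X in mu X](_ : _ = set0) ?nam0// -subset0 => x /=.
  by rewrite normr0 ltNge (ltW c0).
move=> /asboolP f0 /asboolP g0; apply/asboolP => c c0.
have a1 : 0 < `|a| + 1 by rewrite ltr_wpDl.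
have [K K1 H] := nam_linear_gt mu_sub.
have s0 : 0 < c / 2 / (`|a| + 1) by rewrite !divr_gt0.
have t0 : 0 < c / 2 by rewrite divr_gt0.
apply/eqP; rewrite eq_le nam_ge0 ?andbT; last exact: measurable_gt_norm.
have := H a f g (c / 2 / (`|a| + 1)) (c / 2).
rewrite f0// g0// adde0 mule0; apply: le_trans.
apply: nam_le; [exact: measurable_gt_norm..|] => x /=.
apply: le_lt_trans; rewrite [leRHS]splitr lerD2r mulrCA ler_piMr ?ltW//.
by rewrite ltr_pdivrMr// mul1r ltrDl.
Qed.
HB.instance Definition _ := GRing.isSubmodClosed.Build R _
  (sugeno_null mu_sub : {pred mfunL})
  sugeno_null_submod_closed.

Record sugeno_space := SugenoSpace {
  sugeno_val :> mfunL ;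
  _ : sugeno_finite mu_sub sugeno_val }.

HB.instance Definition _ := [isSub for sugeno_val].
HB.instance Definition _ := [Choice of sugeno_space by <:].
HB.instance Definition _ := [SubChoice_isSubLmodule of sugeno_space by <:].

(* [f] and [g] are identified when [f - g] is in [sugeno_null], that is when
   [mu {|f - g| > c} = 0] for all [c > 0]. *)
Definition mfun_quot := Quotient.quot (sugeno_null mu_sub).

HB.instance Definition _ := GRing.Zmodule.on mfun_quot.
HB.instance Definition _ := EqQuotient.on mfun_quot.

Definition mfun_quot_scale (a : R) (u : mfun_quot) : mfun_quot :=
  \pi_mfun_quot (a *: repr u).

Lemma pi_mfun_quotP (f g : mfunL) :
  reflect (forall c : R, 0 < c -> mu [set x | c < `|f x - g x|] = 0%E)
    (\pi_mfun_quot f == \pi_mfun_quot g).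
Proof. rewrite -Quotient.idealrBE; exact: asboolP. Qed.

Lemma pi_mfun_quotD (f g : mfunL) :
  \pi_mfun_quot (f + g) = \pi_mfun_quot f + \pi_mfun_quot g.
Proof. by rewrite !piE. Qed.

Lemma pi_mfun_quot_scale a (f : mfunL) :
  mfun_quot_scale a (\pi_mfun_quot f) = \pi_mfun_quot (a *: f).
Proof.
apply/eqP; rewrite /mfun_quot_scale -Quotient.idealrBE -scalerBr rpredZ//.
by rewrite Quotient.idealrBE reprK.
Qed.

Fact mfun_quot_scaleA a b (u : mfun_quot) :
  mfun_quot_scale a (mfun_quot_scale b u) = mfun_quot_scale (a * b) u.
Proof.
by rewrite -[u]reprK [mfun_quot_scale b _]pi_mfun_quot_scale !pi_mfun_quot_scale
  scalerA.
Qed.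

Fact mfun_quot_scale1 : left_id 1 mfun_quot_scale.
Proof. by move=> u; rewrite -[u]reprK !pi_mfun_quot_scale scale1r. Qed.

Fact mfun_quot_scaleDr : right_distributive mfun_quot_scale +%R.
Proof.
move=> a u v; rewrite -[u]reprK -[v]reprK -pi_mfun_quotD !pi_mfun_quot_scale.
by rewrite scalerDr pi_mfun_quotD.
Qed.

Fact mfun_quot_scaleDl u :
  {morph mfun_quot_scale^~ u : a b / a + b >-> a + b}.
Proof.
move=> a b; rewrite -[u]reprK !pi_mfun_quot_scale.
by rewrite scalerDl pi_mfun_quotD.
Qed.

HB.instance Definition _ := GRing.Zmodule_isLmodule.Build R mfun_quot
  mfun_quot_scaleA mfun_quot_scale1 mfun_quot_scaleDr mfun_quot_scaleDl.

End function_space.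

Section quotient_space.
Context d (X : measurableType d) (R : realType)
  (mu : nonadditive_measure X R).
Local Notation mfunL := [the lmodType R of {mfun X >-> R}].

Definition sugeno_quot_finite (mu_sub : relaxed_subadditive mu) :
    {pred mfun_quot mu_sub} :=
  fun u => `[< exists2 f : mfunL,
    f \in sugeno_finite mu_sub & u = \pi_(mfun_quot mu_sub) f >].
Arguments sugeno_quot_finite mu_sub : clear implicits.

Hypothesis mu_sub : relaxed_subadditive mu.

Lemma sugeno_quot_submod_closed : submod_closed (sugeno_quot_finite mu_sub).
Proof.
split=> [|a u v /asboolP[f ff ->] /asboolP[g gf ->]]; apply/asboolP.
  by exists 0; [exact: rpred0|rewrite piE].
exists (a *: f + g); first by rewrite rpredD ?rpredZ.
by rewrite pi_mfun_quotD -pi_mfun_quot_scale.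
Qed.
HB.instance Definition _ := GRing.isSubmodClosed.Build _ _
  (sugeno_quot_finite mu_sub) sugeno_quot_submod_closed.

Record sugeno_quot := SugenoQuot {
  sugeno_quot_val :> mfun_quot mu_sub ;
  _ : sugeno_quot_finite mu_sub sugeno_quot_val }.

HB.instance Definition _ := [isSub for sugeno_quot_val].
HB.instance Definition _ := [Choice of sugeno_quot by <:].
HB.instance Definition _ := [SubChoice_isSubLmodule of sugeno_quot by <:].

Variables p q : R.

Definition space_prenorm (f : sugeno_space mu_sub) : \bar R :=
  sugeno_prenorm mu p q (sugeno_val f).

(* The value does not depend on the representative when [mu] is
   null-additive. *)
Definition quot_prenorm (u : sugeno_quot) : \bar R :=
  sugeno_prenorm mu p q (repr (sugeno_quot_val u)).

End quotient_space.

Arguments space_prenorm {d X R mu} mu_sub p q f.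
Arguments quot_prenorm {d X R mu} mu_sub p q u.

Definition sphere (R : realType) (V : zmodType) (N : V -> \bar R)
    (f : V) (r : R) : set V :=
  [set g | (N (f - g)%R < r%:E)%E].

(* A copy of [V] that carries the topology defined by the spheres of [N];
   a sphere is not assumed to be open. *)
Definition sphere_space (R : realType) (V : lmodType R) (N : V -> \bar R) :
  Type := V.

Section sphere_topology.
Context (R : realType) (V : lmodType R) (N : V -> \bar R).

HB.instance Definition _ := GRing.Lmodule.on (sphere_space N).

Definition sphere_open (G : set (sphere_space N)) :=
  forall f, G f -> exists2 r : R, 0 < r & sphere N f r `<=` G.

Fact sphere_openT : sphere_open setT.
Proof. by move=> f _; exists 1. Qed.

Fact sphere_openI : setI_closed sphere_open.
Proof.
move=> G H oG oH f [/oG[r r0 rG] /oH[s s0 sH]].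
exists (Order.min r s); first by rewrite lt_min r0.
move=> g; rewrite /sphere/= EFin_min lt_min => /andP[gr gs].
by split; [exact: rG|exact: sH].
Qed.

Fact sphere_open_bigcup (I : Type) (G : I -> set (sphere_space N)) :
  (forall i, sphere_open (G i)) -> sphere_open (\bigcup_i G i).
Proof.
move=> oG f [i _ /oG[r r0 rG]]; exists r => //.
by move=> g /rG Gg; exists i.
Qed.

HB.instance Definition _ := isOpenTopological.Build (sphere_space N)
  sphere_openT sphere_openI sphere_open_bigcup.

Lemma open_sphereE : @open (sphere_space N) = sphere_open.
Proof. by []. Qed.

Definition open_sphere_condition :=
  forall (f : sphere_space N) (r : R), 0 < r ->
    open (sphere N f r : set (sphere_space N)).

End sphere_topology.

Definition topological_linear_space (R : realType)
    (E : preTopologicalLmodType R) :=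
  continuous (fun x : E * E => x.1 + x.2) /\
  continuous (fun z : R^o * E => z.1 *: z.2).

(* [completely_regular_space] alone does not include the T1 axiom;
   [uniform_separatorP] relates it to separation by continuous functions
   into [0, 1]. *)
Definition tychonoff_space (T : topologicalType) :=
  accessible_space T /\ completely_regular_space T.

(* Main.v *)
Require Import Defs.
From HB Require Import structures.
From mathcomp Require Import all_boot all_order all_algebra.
From mathcomp Require Import all_classical all_reals all_analysis.
From mathcomp Require Import ring.
Import Order.TTheory GRing.Theory Num.Theory.
Import numFieldNormedType.Exports.
Local Open Scope classical_set_scope.
Local Open Scope ring_scope.
Local Open Scope quotient_scope.
Set Implicit Arguments.
Unset Strict Implicit.
Unset Printing Implicit Defensive.

(** Write tail f s for mu {s < |f|}. Unwinding the supremum and the powers,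
    the prenorm of f is below r exactly when tail f s < r ^ p for some
    0 <= s < (q / p) ^ (1 / q) * r ([sugeno_prenorm_ltP]). Hence the spheres
    around 0 and the sets {f | tail f a < b}, for a, b > 0, refine each other:
    the topology is that of convergence in mu-measure
    ([prenorm_lt_of_tail], [tail_lt_of_prenorm]).

    Each hypothesis on mu then yields one property of the prenorm
    ([sugeno_linear_prenorm]). Autocontinuity from above lets a tail absorb
    another function of small tail, so that a point of a sphere has a smaller
    sphere around it inside the first: this is the open sphere condition.
    Relaxed subadditivity turns two small tails into a small tail of the sum:
    this is continuity of addition. Order continuity, applied to the sets
    {n < |f|}, which decrease to the empty set, makes b *: f tend to 0 with b:
    this is what joint continuity of the scalar action needs besides the
    uniform bound for bounded scalars.

    These properties are collected in [linear_prenorm], from which the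
    topological statements follow for any module ([sphere_space_linear],
    [open_sphere]). They are proved once, for all measurable functions, and
    carried to the function space and to its quotient by [linear_prenorm_lift];
    for the quotient, the map used is the choice of a representative, which is
    linear only up to null functions, and the prenorm does not see those
    ([prenorm_le_congr]).

    Finally the translates of the neighbourhoods of 0 form a uniformity, so
    every topological linear space is completely regular; the quotient is
    moreover T1 because a function of prenorm 0 is null. *)

(** * Complete regularity of topological groups *)

(** A copy of [M] on which the uniformity of translations is declared, so that
    it cannot clash with a uniformity already present on [M]. *)
Definition translation_uniform (M : topologicalZmodType) : Type := M.

Section translation_uniformity.
Variable M : topologicalZmodType.

HB.instance Definition _ := Topological.on (translation_uniform M).

Definition translation_entourage : set_system (M * M) :=
  [set E | exists2 U, nbhs (0 : M) U & forall x y, U (x - y) -> E (x, y)].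

(** The map [u |-> x - u] is a continuous involution exchanging [0] and [x]. *)
Lemma nbhs_translate (x : M) (A : set M) :
  nbhs x A <-> nbhs (0 : M) [set u | A (x - u)].
Proof.
have h (a : M) : continuous (fun u : M => a - u).
  move=> u; apply: (@continuous_comp _ (M * M)%type _ (fun u => (a, u))
    (fun z : M * M => z.1 - z.2)); last exact: sub_continuous.
  by apply: cvg_pair; [exact: cvg_cst|exact: cvg_id].
split=> [xA|A0]; first by apply: (h x 0); rewrite subr0.
have := h x x; rewrite /continuous_at subrr => /(_ _ A0) /=.
by rewrite nbhs_simpl /=; apply: filterS => u /=; rewrite subKr.
Qed.

Fact translation_entourage_filter : Filter translation_entourage.
Proof.
split; first by exists setT => //; exact: filterT.
  move=> A B [U U0 UA] [V V0 VB]; exists (U `&` V); first exact: filterI.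
  by move=> x y [/UA ? /VB].
by move=> A B AB [U U0 UA]; exists U => // x y /UA /AB.
Qed.

Fact translation_entourage_diagonal (A : set (M * M)) :
  translation_entourage A -> diagonal `<=` A.
Proof.
move=> [U /nbhs_singleton U0 UA] [x y]; rewrite /diagonal/= => ->.
by apply: UA; rewrite subrr.
Qed.

Fact translation_entourage_inv (A : set (M * M)) :
  translation_entourage A -> translation_entourage (A^-1)%relation.
Proof.
move=> [U U0 UA]; exists [set u | U (- u)].
  by apply: (opp_continuous (0 : M)); rewrite oppr0.
by move=> x y /=; rewrite opprB => /UA.
Qed.

Fact translation_entourage_split (A : set (M * M)) :
  translation_entourage A ->
  exists2 B, translation_entourage B & (B \; B `<=` A)%relation.
Proof.
move=> [U U0 UA].
have := @add_continuous M (0, 0) U; rewrite /= addr0.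
move=> /(_ U0)[[V W] /= [V0 W0] VW].
exists [set z | (V `&` W) (z.1 - z.2)].
  by exists (V `&` W) => //; exact: filterI.
move=> [x z] [y /= [Vxy _] [_ Wyz]]; apply: UA.
by have := VW (x - y, y - z) (conj Vxy Wyz); rewrite /= addrA subrK.
Qed.

Fact translation_nbhsE :
  @nbhs _ (translation_uniform M) = nbhs_ translation_entourage.
Proof.
apply/funext => x; rewrite nbhs_E; apply/seteqP; split=> A.
  move=> /nbhs_translate A0.
  exists [set z | A (x - (z.1 - z.2))]; first by exists [set u | A (x - u)].
  by move=> y /xsectionP /=; rewrite subKr.
move=> [E [U U0 UE] EA]; apply/nbhs_translate.
apply: filterS U0 => u Uu /=; apply/EA/xsectionP/UE.
by rewrite subKr.
Qed.

HB.instance Definition _ := Nbhs_isUniform.Build (translation_uniform M)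
  translation_entourage_filter translation_entourage_diagonal
  translation_entourage_inv translation_entourage_split translation_nbhsE.

End translation_uniformity.

(** Complete regularity is uniformizability: the uniformity of translations
    induces the given topology ([translation_nbhsE]). *)
Lemma topological_zmod_completely_regular (R : realType)
  (M : topologicalZmodType) : completely_regular_space M.
Proof. exact: (@uniform_completely_regular R (translation_uniform M)). Qed.

Lemma topological_linear_completely_regular (R : realType)
    (E : preTopologicalLmodType R) :
  topological_linear_space E -> completely_regular_space E.
Proof.
move=> [addc scalec].
pose addM := PreTopologicalNmodule_isTopologicalNmodule.Build E addc.
pose scaleM := TopologicalNmodule_isTopologicalLmodule.Build R E scalec.
pose M : topologicalLmodType R :=
  HB.pack (PreTopologicalLmodule.sort E) addM scaleM.
exact: (@topological_zmod_completely_regular R M).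
Qed.

(** * Topologies defined by the spheres of a prenorm *)

Section prenorm_axioms.
Context (R : realType) (V : lmodType R) (N : V -> \bar R).

(** Substitutes for the axioms of a norm, when [N] need be neither homogeneous
    nor subadditive. [prenorm_shift] makes the spheres open, [prenormD] makes addition continuous, and [prenormZ] with
    [prenorm_absorbing] make the scalar action continuous. *)
Record linear_prenorm := {
  prenorm_shift : forall f (r : R), (N f < r%:E)%E ->
    exists2 e : R, 0 < e & forall g, (N g < e%:E)%E -> (N (f + g) < r%:E)%E ;
  prenormD : forall r : R, 0 < r -> exists2 e : R, 0 < e &
    forall f g, (N f < e%:E)%E -> (N g < e%:E)%E -> (N (f + g) < r%:E)%E ;
  prenormZ : forall a r : R, 0 < r -> exists2 e : R, 0 < e &
    forall b f, `|b| <= a -> (N f < e%:E)%E -> (N (b *: f) < r%:E)%E ;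
  prenorm_absorbing : forall f (r : R), 0 < r -> exists2 e : R, 0 < e &
    forall b, `|b| < e -> (N (b *: f) < r%:E)%E }.

Hypothesis HN : linear_prenorm.
Local Notation E := (sphere_space N).

Lemma prenorm0 (r : R) : 0 < r -> (N 0 < r%:E)%E.
Proof.
by move=> /(prenorm_absorbing HN 0)[e e0 /(_ 0)]; rewrite scale0r normr0; exact.
Qed.

Lemma open_sphere : open_sphere_condition N.
Proof.
move=> f r r0; rewrite open_sphereE => g /(prenorm_shift HN)[e e0 He].
exists e => // h /He.
by rewrite /sphere/= addrA subrK.
Qed.

(** In the topology defined by spheres, a sphere need not be a neighbourhood of
    its centre; here it is one because it is open. *)
Lemma nbhs_sphereP (f : E) (A : set E) :
  nbhs f A <-> exists2 r : R, 0 < r & sphere N f r `<=` A.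
Proof.
rewrite nbhsE; split=> [[B [oB Bf] BA]|[r r0 rA]].
  by have [r r0 rB] := oB f Bf; exists r => //; exact: subset_trans BA.
exists (sphere N f r) => //; split; first exact: open_sphere.
by rewrite /sphere/= subrr; exact: prenorm0.
Qed.

Lemma sphere_space_linear : topological_linear_space E.
Proof.
split=> [[f g] A /= /nbhs_sphereP[r r0 rA]|[a f] A /= /nbhs_sphereP[r r0 rA]].
  have [e e0 De] := prenormD HN r0.
  exists (sphere N f e, sphere N g e).
    by split; apply/nbhs_sphereP; exists e.
  move=> [f' g'] [/= ff' gg']; apply: rA.
  by rewrite /sphere/= opprD addrACA; exact: De.
(* The increment is split as a f - b g = (a - b) f + b (f - g), where
   |b| <= |a| + 1. *)
have [e e0 De] := prenormD HN r0.
have [e1 e10 Ae] := prenorm_absorbing HN f e0.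
have [e2 e20 Ze] := prenormZ HN (`|a| + 1) e0.
exists (ball a (Order.min e1 1), sphere N f e2).
  split; last by apply/nbhs_sphereP; exists e2.
  by apply: (@nbhsx_ballx R R^o a); rewrite lt_min e10/=.
move=> [b g] [/=]; rewrite /ball/= lt_min => /andP[be1 b1] fg; apply: rA.
rewrite /sphere/= (_ : a *: f - b *: g = (a - b) *: f + b *: (f - g)).
  apply: De; [exact: Ae|apply: Ze => //].
  by rewrite -(subKr a b) (le_trans (ler_normB _ _))// lerD2l ltW.
by rewrite scalerBl scalerBr addrA subrK.
Qed.

Lemma sphere_space_tychonoff :
  (forall f, (forall r : R, 0 < r -> (N f < r%:E)%E) -> f = 0) ->
  tychonoff_space E.
Proof.
move=> N0; split; last first.
  exact: topological_linear_completely_regular sphere_space_linear.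
move=> f g fg.
have [r r0 Nr] : exists2 r : R, 0 < r & ~ (N ((f : V) - g) < r%:E)%E.
  apply: contrapT => nr; move/eqP: fg; apply; apply/eqP.
  rewrite -subr_eq0; apply/eqP/N0 => r r0; apply: contrapT => Nr.
  by apply: nr; exists r.
exists (sphere N f r); split; [exact: open_sphere| |]; rewrite inE//.
by rewrite /sphere/= subrr; exact: prenorm0.
Qed.

End prenorm_axioms.

(** The map [rep] is only required to be linear up to the prenorm: a choice of
    representatives in a quotient is not linear. *)
Lemma linear_prenorm_lift (R : realType) (V W : lmodType R) (N : V -> \bar R)
    (rep : W -> V) :
    (forall u v : W, (N (rep (u + v)%R) <= N (rep u + rep v)%R)%E) ->
    (forall a (u : W), (N (rep (a *: u)%R) <= N (a *: rep u)%R)%E) ->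
  linear_prenorm N -> linear_prenorm (N \o rep).
Proof.
move=> ND NZ [sh D Z ab]; split=> /=.
- move=> f r /sh[e e0 H]; exists e => // g /H; exact: le_lt_trans.
- by move=> r /D[e e0 H]; exists e => // f g /H Hf /Hf; exact: le_lt_trans.
- move=> a r /(Z a)[e e0 H]; exists e => // b f /H Hf /Hf; exact: le_lt_trans.
- move=> f r /(ab (rep f))[e e0 H]; exists e => // b /H; exact: le_lt_trans.
Qed.

(** * Spheres of the Sugeno-Lorentz prenorm *)

Section sugeno_integral.
Context d (X : measurableType d) (R : realType).
Implicit Types r s t : R.

Lemma poweR_ltP (x : \bar R) (a r : R) : (0 <= x)%E -> 0 < a -> 0 < r ->
  (x `^ a < r%:E)%E <-> (x < (r `^ a^-1)%:E)%E.
Proof.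
move=> x0 a0 r0; have rE : r = (r `^ a^-1) `^ a.
  by rewrite -powRrM mulVf ?gt_eqF// powRr1// ltW.
case: x x0 => [x|_|//]; last by rewrite poweRyr ?gt_eqF//.
rewrite lee_fin poweR_EFin !lte_fin => x0; split; last first.
  by move=> xr; rewrite [ltRHS]rE gt0_ltr_powR// nnegrE powR_ge0.
rewrite [ltRHS]rE; apply: contraTT; rewrite -!leNgt => rx.
by rewrite ge0_ler_powR ?nnegrE ?powR_ge0// ltW.
Qed.

(** As [t] grows, [t] increases and the measure of {t < h} decreases, so the
    supremum of their minima lies below any [Order.max t (nu {t < h})]. *)
Lemma sugeno_ltP (nu : set X -> \bar R) (h : X -> R) (c : R) : 0 < c ->
  (forall s t, 0 <= s -> s <= t ->
     (nu [set x | (t < h x)%R] <= nu [set x | (s < h x)%R])%E) ->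
  (sugeno nu h < c%:E)%E <->
  exists t, [/\ 0 <= t, t < c & (nu [set x | (t < h x)%R] < c%:E)%E].
Proof.
move=> c0 nu_le; split=> [Sc|[t [t0 tc nutc]]].
  (* A level t strictly above the integral cannot attain the minimum. *)
  have [t [t0 tc St]] : exists t, [/\ 0 <= t, t < c & (sugeno nu h < t%:E)%E].
    case: (sugeno nu h) Sc => [s|//|_]; last by exists 0; split; rewrite ?ltNyr.
    rewrite lte_fin => sc; exists ((Order.max s 0 + c) / 2).
    have mc : Order.max s 0 < c by rewrite gt_max sc.
    have ms : s <= Order.max s 0 by rewrite le_max lexx.
    have m0 : 0 <= Order.max s 0 by rewrite le_max lexx orbT.
    rewrite lte_fin midf_lt//; split => //.
      by rewrite divr_ge0// addr_ge0// ltW.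
    by rewrite (le_lt_trans ms)// midf_lt.
  exists t; split=> //.
  have : (Order.min t%:E (nu [set x | (t < h x)%R]) < t%:E)%E.
    by apply: le_lt_trans St; apply: ereal_sup_ubound; exists t.
  by rewrite gt_min ltxx/= => /lt_trans; apply; rewrite lte_fin.
have tnuc : (Order.max t%:E (nu [set x | (t < h x)%R]) < c%:E)%E.
  by rewrite gt_max lte_fin tc.
apply: le_lt_trans tnuc; apply: ge_ereal_sup => _ [s /= s0 <-].
rewrite ge_min !le_max lee_fin.
by have [//|ts] := leP s t; rewrite (nu_le _ _ t0 (ltW ts)) !orbT.
Qed.

End sugeno_integral.

Section sugeno.
Context d (X : measurableType d) (R : realType) (mu : nonadditive_measure X R).
Variables p q : R.
Hypotheses (p_gt0 : 0 < p) (q_gt0 : 0 < q).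
Local Notation mfunL := [the lmodType R of {mfun X >-> R}].
Implicit Types (f g : mfunL) (r s t : R).

Local Notation N := (fun f : mfunL => sugeno_prenorm mu p q f).
Local Notation tail f s := (mu [set x | (s < `|f x|)%R]).

Lemma tail_ge0 f s : (0 <= tail f s)%E.
Proof. by apply: nam_ge0; exact: measurable_gt_norm. Qed.

Lemma tail_le f s t : s <= t -> (tail f t <= tail f s)%E.
Proof.
move=> st; apply: nam_le; [exact: measurable_gt_norm..|].
by move=> x /=; exact: le_lt_trans.
Qed.

(** The levels of [p * |f| ^ q / q] and of [|f|] correspond under the increasing
    bijection [phi s = p * s ^ q / q], which sends (q / p) ^ (1 / q) * r to
    r ^ q; and mu ^ (q / p) < r ^ q means mu < r ^ p. *)
Lemma sugeno_prenorm_ltP f r : 0 < r ->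
  (N f < r%:E)%E <-> exists s,
    [/\ 0 <= s, s < (q / p) `^ q^-1 * r & (tail f s < (r `^ p)%:E)%E].
Proof.
move=> r0; have [qN0 pN0] := (lt0r_neq0 q_gt0, lt0r_neq0 p_gt0).
pose phi s := p * s `^ q / q.
have phi_lt s t : 0 <= s -> 0 <= t -> (phi s < phi t) = (s < t).
  move=> s0 t0; rewrite /phi ltr_pM2r ?invr_gt0// ltr_pM2l//.
  have [ts|st] := leP t s; last by rewrite gt0_ltr_powR.
  by rewrite ltNge ge0_ler_powR ?nnegrE// ltW.
have phiK t : 0 <= t -> phi ((q / p * t) `^ q^-1) = t.
  move=> t0; have qpt : 0 <= q / p * t by rewrite mulr_ge0// divr_ge0 ?ltW.
  rewrite /phi -powRrM mulVf// powRr1//; field; exact/andP.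
have phir : phi ((q / p) `^ q^-1 * r) = r `^ q.
  have qp0 : 0 <= q / p by rewrite divr_ge0 ?ltW.
  rewrite -[RHS]phiK ?powR_ge0// [in RHS]powRM ?powR_ge0//.
  by rewrite -[_ `^ q `^ _]powRrM mulfV// powRr1// ltW.
have kr0 : 0 <= (q / p) `^ q^-1 * r by rewrite mulr_ge0 ?powR_ge0// ltW.
have gt_phi s : 0 <= s ->
    [set x | phi s < p * `|f x| `^ q / q] = [set x | s < `|f x|].
  by move=> s0; apply/seteqP; split => x /=; rewrite -[_ / q]/(phi _) phi_lt.
have gt_powP s : 0 <= s -> (tail f s `^ (q / p) < (r `^ q)%:E)%E <->
    (tail f s < (r `^ p)%:E)%E.
  move=> s0; have -> : r `^ p = (r `^ q) `^ (q / p)^-1.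
    by rewrite -powRrM invf_div mulrCA mulfV// mulr1.
  by apply: poweR_ltP; rewrite ?tail_ge0 ?divr_gt0 ?powR_gt0.
rewrite /sugeno_prenorm.
set nu := fun A => _; set h := fun x => _.
have gt_h t : 0 <= t ->
    [set x | t < h x] = [set x | (q / p * t) `^ q^-1 < `|f x|].
  by move=> t0; rewrite -gt_phi ?powR_ge0// phiK.
have S0 : (0 <= sugeno nu h)%E.
  apply: (@le_trans _ _ (Order.min 0 (nu [set x | (0 < h x)%R]))%E).
    by rewrite le_min lexx poweR_ge0.
  by apply: ereal_sup_ubound; exists 0 => //=.
rewrite poweR_ltP ?invr_gt0// invrK sugeno_ltP ?powR_gt0//; last first.
  move=> s t s0 st; have t0 := le_trans s0 st.
  rewrite !gt_h// /nu.
  apply: gt0_ler_poweR; rewrite ?in_itv/= ?tail_ge0 ?leey//.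
    by rewrite divr_ge0 ?ltW.
  apply: tail_le; have qp0 : 0 <= q / p by rewrite divr_ge0 ?ltW.
  apply: ge0_ler_powR; last exact: ler_wpM2l.
  - by rewrite invr_ge0 ltW.
  - by rewrite nnegrE mulr_ge0.
  - by rewrite nnegrE mulr_ge0.
split=> [[t [t0 tr nut]]|[s [s0 sr fs]]].
  exists ((q / p * t) `^ q^-1); split; first exact: powR_ge0.
    by rewrite -phi_lt ?powR_ge0// phiK// phir.
  by apply/gt_powP; rewrite ?powR_ge0// -gt_phi ?powR_ge0// phiK.
exists (phi s); split; first by rewrite divr_ge0 ?mulr_ge0 ?powR_ge0 ?ltW.
  by rewrite -phir phi_lt.
by rewrite gt_phi//; exact/gt_powP.
Qed.

Let k_gt0 : 0 < (q / p) `^ q^-1.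
Proof. by rewrite powR_gt0// divr_gt0. Qed.

Lemma prenorm_lt_of_tail r : 0 < r -> exists2 a, 0 < a &
  exists2 b, 0 < b & forall f, (tail f a < b%:E)%E -> (N f < r%:E)%E.
Proof.
move=> r0; have kr0 := mulr_gt0 k_gt0 r0.
exists ((q / p) `^ q^-1 * r / 2); first by rewrite divr_gt0.
exists (r `^ p); rewrite ?powR_gt0// => f fr; apply/sugeno_prenorm_ltP => //.
exists ((q / p) `^ q^-1 * r / 2); split=> //; first by rewrite divr_ge0 ?ltW.
by rewrite ltr_pdivrMr// ltr_pMr// ltr1n.
Qed.

Lemma tail_lt_of_prenorm (a b : R) : 0 < a -> 0 < b ->
  exists2 e, 0 < e & forall f, (N f < e%:E)%E -> (tail f a < b%:E)%E.
Proof.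
move=> a0 b0; exists (Order.min (a / (q / p) `^ q^-1) (b `^ p^-1)).
  by rewrite lt_min divr_gt0//= powR_gt0.
set e := Order.min _ _ => f.
have e0 : 0 < e by rewrite lt_min divr_gt0//= powR_gt0.
move/(sugeno_prenorm_ltP _ e0) => [s [s0 se fs]].
have sa : s <= a.
  apply/ltW/(lt_le_trans se); rewrite mulrC -ler_pdivlMr//.
  by rewrite /e ge_min lexx.
apply: (le_lt_trans (tail_le f sa)); apply: (lt_le_trans fs); rewrite lee_fin.
have -> : b = (b `^ p^-1) `^ p by rewrite -powRrM mulVf ?gt_eqF// powRr1// ltW.
rewrite ge0_ler_powR ?nnegrE ?powR_ge0 ?(ltW p_gt0) ?(ltW e0)//.
by rewrite /e ge_min lexx orbT.
Qed.

(** * The hypotheses on the measure *)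

Hypotheses (mu_sub : relaxed_subadditive mu) (mu_oc : order_continuous mu)
  (mu_ac : autocontinuous_from_above mu).

(** The sequential hypothesis in epsilon-delta form: sets B n of measure less
    than 1 / (n + 1) violating the conclusion would contradict it. *)
Lemma autocontinuous_small (A : set X) (c : \bar R) :
    measurable A -> (mu A < c)%E ->
  exists2 b : R, 0 < b & forall B, measurable B -> (mu B < b%:E)%E ->
    (mu (A `|` B) < c)%E.
Proof.
move=> mA Ac; apply: contrapT => nb.
have /choice[B HB] : forall n : nat, exists B, [/\ measurable B,
    (mu B < (n.+1%:R^-1)%:E)%E & ~ (mu (A `|` B) < c)%E].
  move=> n; apply: contrapT => nB; apply: nb; exists n.+1%:R^-1 => // B mB Bn.
  by apply: contrapT => ABc; apply: nB; exists B.
have mB n : measurable (B n) by have [] := HB n.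
have B0 : (fun n => mu (B n)) @ \oo --> 0%E.
  apply: (@squeeze_cvge _ _ _ _ (cst 0%E) _ (fun n => (n.+1%:R^-1)%:E)).
  - by apply: nearW => n /=; rewrite nam_ge0//= ltW//; have [] := HB n.
  - exact: cvg_cst.
  - by apply: cvg_EFin; [exact: nearW|exact: cvg_harmonic].
have /(_ [set x | x < c]%E) := mu_ac mA mB B0.
have nc : nbhs (mu A) [set x | (x < c)%E].
  by apply: open_nbhs_nbhs; split; [exact: open_ereal_lt_ereal|].
by move=> /(_ nc)[n _ /(_ n (leqnn n))] /=; have [] := HB n.
Qed.

(** The sets {n < |f|} decrease to the empty set because [f] is finite. *)
Lemma order_continuous_tail f (b : R) : 0 < b ->
  exists2 s, 0 < s & (tail f s < b%:E)%E.
Proof.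
move=> b0.
have gt0 : (fun n : nat => tail f n%:R) @ \oo --> 0%E.
  apply: mu_oc => [n||]; first exact: measurable_gt_norm.
    apply/nonincreasing_seqP => n; apply/subsetPset => x /=.
    by apply: le_lt_trans; rewrite ler_nat.
  rewrite -subset0 => x /(_ (Num.truncn `|f x|).+1 I) /=.
  by rewrite ltNge (ltW (truncnS_gt _)).
have b_nbhs : nbhs 0%E [set x : \bar R | (x < b%:E)%E].
  apply: open_nbhs_nbhs; split; first exact: open_ereal_lt_ereal.
  by rewrite /= lte_fin.
have [n _ /(_ n (leqnn n)) /= fn] := gt0 _ b_nbhs.
by exists n.+1%:R => //; apply: le_lt_trans fn; apply: tail_le; rewrite ler_nat.
Qed.

Lemma sugeno_linear_prenorm : linear_prenorm N.
Proof.
split.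
- move=> f r fr.
  have r0 : 0 < r by rewrite -lte_fin; apply: le_lt_trans fr; exact: poweR_ge0.
  have [s [s0 sr fs]] := (sugeno_prenorm_ltP _ r0).1 fr.
  have [b b0 Hb] := autocontinuous_small (measurable_gt_norm f s) fs.
  (* {s + a < |f + g|} lies in the union of {s < |f|} and {a < |g|}, and the
     choice of a keeps s + a below (q / p) ^ (1 / q) * r. *)
  have a0 : 0 < ((q / p) `^ q^-1 * r - s) / 2 by rewrite divr_gt0// subr_gt0.
  have [e e0 He] := tail_lt_of_prenorm a0 b0.
  exists e; [exact: e0|move=> g /He gb].
  apply/sugeno_prenorm_ltP => //; exists (s + ((q / p) `^ q^-1 * r - s) / 2).
  split; first by rewrite addr_ge0// ltW.
    by rewrite -ltrBrDl ltr_pdivrMr// ltr_pMr ?subr_gt0// ltr1n.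
  apply: le_lt_trans (Hb _ (measurable_gt_norm _ _) gb).
  apply: nam_le; first exact: measurable_gt_norm.
    by apply: measurableU; exact: measurable_gt_norm.
  move=> x /= fgx; have [|fx] := ltP s `|f x|; [by left|right].
  rewrite -(ltrD2l s); apply: (lt_le_trans fgx).
  by rewrite (le_trans (ler_normD _ _))// lerD2r.
- move=> r r0; have [K K1 H] := nam_linear_gt mu_sub.
  have K0 : 0 < K by exact: lt_le_trans K1.
  have [a a0 [b b0 Hab]] := prenorm_lt_of_tail r0.
  have a20 : 0 < a / 2 by rewrite divr_gt0.
  have bK0 : 0 < b / (K * 2) by rewrite divr_gt0// mulr_gt0.
  have [e e0 He] := tail_lt_of_prenorm a20 bK0.
  exists e; [exact: e0|move=> f g /He fb /He gb; apply: Hab].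
  have := H 1 f g (a / 2) (a / 2); rewrite normr1 mul1r -splitr scale1r.
  move=> /le_lt_trans; apply.
  rewrite -lte_pdivlMl//.
  apply: (@lt_le_trans _ _ (b / (K * 2) + b / (K * 2))%:E).
    by rewrite EFinD lteD.
  by rewrite -EFinM lee_fin invfM mulrCA mulrA -splitr mulrC.
- move=> a r r0; have [a1 a10 [b b0 Hab]] := prenorm_lt_of_tail r0.
  have a'0 : 0 < `|a| + 1 by rewrite ltr_wpDl.
  have [e e0 He] := tail_lt_of_prenorm (divr_gt0 a10 a'0) b0.
  exists e => // c f ca /He fb; apply: Hab; apply: le_lt_trans fb.
  apply: nam_le; [exact: measurable_gt_norm..|] => x /=.
  rewrite [X in _ < `|X|](_ : _ = c * f x)// normrM ltr_pdivrMr//.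
  move=> /lt_le_trans; apply; rewrite mulrC ler_wpM2l//.
  by rewrite (le_trans ca)// (le_trans (ler_norm _))// lerDl.
- move=> f r r0; have [a a0 [b b0 Hab]] := prenorm_lt_of_tail r0.
  have [s s0 fs] := order_continuous_tail f b0.
  exists (a / s); first exact: divr_gt0.
  move=> c cas; apply: Hab; apply: le_lt_trans fs.
  apply: nam_le; [exact: measurable_gt_norm..|] => x /=.
  rewrite [X in _ < `|X|](_ : _ = c * f x)// normrM => acf.
  rewrite ltNge; apply/negP => fxs; move: acf; rewrite ltNge => /negP; apply.
  rewrite (le_trans (ler_wpM2l _ fxs))// -ler_pdivlMr//; exact: ltW.
Qed.

Lemma tail_eq0_of_prenorm f : (forall r, 0 < r -> (N f < r%:E)%E) ->
  forall c, 0 < c -> tail f c = 0%E.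
Proof.
move=> Nf c c0; apply/eqP; rewrite eq_le tail_ge0 andbT.
apply/lee_addgt0Pr => b b0; rewrite add0e.
by have [e e0 He] := tail_lt_of_prenorm c0 b0; apply/ltW/He/Nf.
Qed.

(** A null function lies in every sphere around 0, so adding it keeps [f]
    inside each sphere by [prenorm_shift]. *)
Lemma prenorm_le_congr f g :
  (forall c, 0 < c -> tail (g - f) c = 0%E) -> (N g <= N f)%E.
Proof.
move=> gf0; rewrite leNgt; apply/negP => fg.
have [r fr rg] : exists2 r : R, (N f < r%:E)%E & (r%:E <= N g)%E.
  have N0 : (0 <= N f)%E by exact: poweR_ge0.
  have Nfy : (N f < +oo)%E by exact: lt_le_trans fg (leey _).
  case: (N f) N0 Nfy fg => [s _ _|//|//]; case: (N g) => [t|_|//].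
    by rewrite lte_fin => st; exists t; rewrite ?lte_fin.
  by exists (s + 1); rewrite ?lte_fin ?ltrDl ?leey.
have [e e0 He] := prenorm_shift sugeno_linear_prenorm fr.
have [a a0 [b b0 Hab]] := prenorm_lt_of_tail e0.
suff : (N g < r%:E)%E by rewrite ltNge rg.
have gE : g = f + (g - f) by rewrite addrCA subrr addr0.
by rewrite [in N g]gE; apply/He/Hab; rewrite gf0// lte_fin.
Qed.

End sugeno.

(** * The function space and its quotient *)

Section quotient.
Context d (X : measurableType d) (R : realType) (mu : nonadditive_measure X R).
Variables p q : R.
Hypotheses (p_gt0 : 0 < p) (q_gt0 : 0 < q).
Hypotheses (mu_sub : relaxed_subadditive mu) (mu_oc : order_continuous mu)
  (mu_ac : autocontinuous_from_above mu).
Local Notation mfunL := [the lmodType R of {mfun X >-> R}].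

Lemma space_linear_prenorm : linear_prenorm (space_prenorm mu_sub p q).
Proof.
apply: (@linear_prenorm_lift R mfunL (sugeno_space mu_sub)
  (fun f : mfunL => sugeno_prenorm mu p q f) (@sugeno_val _ _ _ _ mu_sub)) =>
  //.
exact: sugeno_linear_prenorm.
Qed.

Local Notation rep :=
  (fun u : sugeno_quot mu_sub => repr (sugeno_quot_val u) : mfunL).

Lemma quot_linear_prenorm : linear_prenorm (quot_prenorm mu_sub p q).
Proof.
apply: (@linear_prenorm_lift R mfunL (sugeno_quot mu_sub)
  (fun f : mfunL => sugeno_prenorm mu p q f) rep).
- move=> u v; apply: prenorm_le_congr => //; apply/pi_mfun_quotP.
  by rewrite pi_mfun_quotD !reprK.
- move=> a u; apply: prenorm_le_congr => //; apply/pi_mfun_quotP.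
  by rewrite -pi_mfun_quot_scale !reprK.
- exact: sugeno_linear_prenorm.
Qed.

Lemma quot_prenorm_eq0 (u : sugeno_quot mu_sub) :
  (forall r : R, 0 < r -> (quot_prenorm mu_sub p q u < r%:E)%E) -> u = 0.
Proof.
move=> /(tail_eq0_of_prenorm p_gt0 q_gt0) u0; apply/val_inj => /=.
transitivity (\pi_(mfun_quot mu_sub) (0 : mfunL)); last by rewrite piE.
rewrite -[LHS]reprK; apply/eqP/pi_mfun_quotP => c /u0 <-.
congr (mu _); apply/funext => x /=; congr (_ < `|_|).
exact: (subr0 (repr (sugeno_quot_val u) x)).
Qed.

End quotient.

Theorem theorem5p1 (d : measure_display) (X : measurableType d)
    (R : realType) (mu : nonadditive_measure X R) (p q : R)
    (p_gt0 : 0 < p) (q_gt0 : 0 < q)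
    (mu_sub : relaxed_subadditive mu)
    (mu_oc : order_continuous mu)
    (mu_ac : autocontinuous_from_above mu) :
  [/\ topological_linear_space (sphere_space (space_prenorm mu_sub p q)),
      open_sphere_condition (space_prenorm mu_sub p q),
      topological_linear_space (sphere_space (quot_prenorm mu_sub p q)),
      open_sphere_condition (quot_prenorm mu_sub p q) &
      tychonoff_space (sphere_space (quot_prenorm mu_sub p q))].
Proof.
have spaceP := space_linear_prenorm p_gt0 q_gt0 mu_sub mu_oc mu_ac.
have quotP := quot_linear_prenorm p_gt0 q_gt0 mu_sub mu_oc mu_ac.
split.
- exact: sphere_space_linear.
- exact: open_sphere.
- exact: sphere_space_linear.
- exact: open_sphere.
- by apply: (sphere_space_tychonoff quotP) => u; exact: quot_prenorm_eq0.
Qed.
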